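(* The metric space $(HQ(\mathbb{D}), d_{\sup})$ is incomplete (i.e. it is not a complete metric space).
   Context: $\mathbb{D} = \{z \in \mathbb{C} : |z| < 1\}$ is the open unit disk. $Q(\mathbb{D})$ denotes the set of all quasiconformal mappings of $\mathbb{D}$ onto $\mathbb{D}$ (orientation-preserving homeomorphisms of $\mathbb{D}$ onto itself that are $K$-quasiconformal for some finite $K \geq 1$; $K$ may depend on the mapping). A complex-valued function $f = u + iv$ on a domain is called harmonic if its real part $u$ and imaginary part $v$ are both real-valued harmonic functions, i.e. $\Delta u = \Delta v = 0$. $HQ(\mathbb{D}) := \{ f \in Q(\mathbb{D}) : f \text{ is harmonic} \}$, endowed with the metric $d_{\sup}(f,g) := \sup_{z \in \mathbb{D}} |f(z) - g(z)|$. *)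

(* Defs.v *)
From HB Require Import structures.
From mathcomp Require Import all_boot all_order all_algebra.
From mathcomp Require Import complex.
From mathcomp Require Import all_classical all_reals all_analysis.

Set Implicit Arguments.
Unset Strict Implicit.
Unset Printing Implicit Defensive.

Import Order.TTheory GRing.Theory Num.Theory.
Import numFieldNormedType.Exports.

Local Open Scope classical_set_scope.
Local Open Scope ring_scope.

(* The complex numbers are packed as a [numClosedFieldType] so that they carry
   the topology that the library attaches to the norm of such a field; this is
   the Euclidean topology of the plane. *)
Definition C (R : realType) : numClosedFieldType := (R[i])%C.

Definition mkC {R : realType} (x y : R) : C R := (x +i* y)%C.
Definition re {R : realType} (z : C R) : R := complex.Re z.
Definition im {R : realType} (z : C R) : R := complex.Im z.

(* The norm [`|z|] of [C R] is itself an element of [C R]; [cmod] is the same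
   number, as a real. *)
Definition cmod {R : realType} (z : C R) : R := re `|z|.

Definition cis {R : realType} (t : R) : C R := mkC (cos t) (sin t).

Definition disk (R : realType) : set (C R) := [set z | cmod z < 1].
Arguments disk : clear implicits.

(* In what follows [A] is meant to be open, so that continuity and
   differentiability on [A] are stated pointwise, for maps of the plane. *)

Section calculus.
Context {R : realType}.
Implicit Types (u : C R -> R) (f : C R -> C R) (A : set (C R)).

Definition partial_x u (z : C R) : R :=
  derive1 (fun t : R => u (mkC t (im z))) (re z).
Definition partial_y u (z : C R) : R :=
  derive1 (fun t : R => u (mkC (re z) t)) (im z).

Definition has_partials u (z : C R) : Prop :=
  derivable (fun t : R => u (mkC t (im z))) (re z) 1 /\
  derivable (fun t : R => u (mkC (re z) t)) (im z) 1.

Definition C1_on A u : Prop :=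
  [/\ forall z, A z -> has_partials u z,
      {in A, continuous (partial_x u)} &
      {in A, continuous (partial_y u)}].

Definition C2_on A u : Prop :=
  [/\ C1_on A u, C1_on A (partial_x u) & C1_on A (partial_y u)].

Definition laplacian u (z : C R) : R :=
  partial_x (partial_x u) z + partial_y (partial_y u) z.

Definition real_harmonic_on A u : Prop :=
  C2_on A u /\ forall z, A z -> laplacian u z = 0.

Definition harmonic_on A f : Prop :=
  real_harmonic_on A (re \o f) /\ real_harmonic_on A (im \o f).

Definition cpartial_x f (z : C R) : C R :=
  mkC (partial_x (re \o f) z) (partial_x (im \o f) z).
Definition cpartial_y f (z : C R) : C R :=
  mkC (partial_y (re \o f) z) (partial_y (im \o f) z).

(* Wirtinger derivatives [f_z = (f_x - i f_y) / 2] and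
   [f_zbar = (f_x + i f_y) / 2] *)
Definition d_z f (z : C R) : C R :=
  (cpartial_x f z - mkC 0 1 * cpartial_y f z) / 2.
Definition d_zbar f (z : C R) : C R :=
  (cpartial_x f z + mkC 0 1 * cpartial_y f z) / 2.

End calculus.

Section quasiconformal.
Context {R : realType}.
Implicit Types (f : C R -> C R).

Definition homeomorphism_of (A : set (C R)) f : Prop :=
  exists g : C R -> C R,
    [/\ {homo f : z / A z}, {homo g : z / A z},
        (forall z, A z -> g (f z) = z) /\ (forall z, A z -> f (g z) = z),
        {in A, continuous f} & {in A, continuous g}].

(* An injective planar map preserves orientation when the image of every small
   positively oriented circle has winding number 1 around the image of its
   centre: the argument [theta] of [f (z0 + r e^{it}) - f z0], chosen
   continuously in [t], increases by 2 pi along the circle. *)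
Definition orientation_preserving_on (A : set (C R)) f : Prop :=
  forall (z0 : C R) (r : R), 0 < r ->
    (forall z, cmod (z - z0) <= r -> A z) ->
    exists theta : R -> R,
      [/\ {within `[0, pi *+ 2], continuous theta},
          (forall t : R, t \in `[0, pi *+ 2] ->
             let w := f (z0 + mkC r 0 * cis t) - f z0 in
             w = mkC (cmod w) 0 * cis (theta t)) &
          theta (pi *+ 2) - theta 0 = pi *+ 2].

Definition abs_continuous (a b : R) (h : R -> C R) : Prop :=
  forall e : R, 0 < e -> exists2 d : R, 0 < d &
    forall (n : nat) (s t : 'I_n -> R),
      (forall i, [/\ a <= s i, s i <= t i & t i <= b]) ->
      trivIset setT (fun i => [set x : R | s i < x < t i]) ->
      \sum_(i < n) (t i - s i) < d ->
      \sum_(i < n) cmod (h (t i) - h (s i)) < e.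

Definition ACL_on (A : set (C R)) f : Prop :=
  forall a b c d : R, a < b -> c < d ->
    (forall x y, a <= x <= b -> c <= y <= d -> A (mkC x y)) ->
    {ae @lebesgue_measure R, forall y,
       c <= y <= d -> abs_continuous a b (fun x => f (mkC x y))} /\
    {ae @lebesgue_measure R, forall x,
       a <= x <= b -> abs_continuous c d (fun y => f (mkC x y))}.

(* The analytic definition.  The partial derivatives of an [ACL_on] map exist
   almost everywhere, so the default value of [derive1] at the points where a
   partial derivative does not exist plays no role. *)
Definition K_quasiconformal_on (A : set (C R)) (K : R) f : Prop :=
  ACL_on A f /\
  {ae (@lebesgue_measure R \x @lebesgue_measure R)%E, forall p,
     A (mkC p.1 p.2) ->
     cmod (d_zbar f (mkC p.1 p.2)) <=
       (K - 1) / (K + 1) * cmod (d_z f (mkC p.1 p.2))}.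

(* quasiconformal mappings of [A] onto [A] *)
Definition quasiconformal_of (A : set (C R)) f : Prop :=
  [/\ homeomorphism_of A f, orientation_preserving_on A f &
      exists2 K : R, 1 <= K & K_quasiconformal_on A K f].

End quasiconformal.

(* Maps with domain [disk R] are represented by total functions; these are
   required to vanish outside of the disk so that two of them are equal as soon
   as they agree on the disk.  Everything in [HQ_qc] and [HQ_harmonic] depends
   only on the restriction to the (open) disk. *)
Record HQ (R : realType) : Type := mkHQ {
  HQ_fun :> C R -> C R ;
  HQ_out : forall z, ~ disk R z -> HQ_fun z = 0 ;
  HQ_qc : quasiconformal_of (disk R) HQ_fun ;
  HQ_harmonic : harmonic_on (disk R) HQ_fun }.

HB.instance Definition _ (R : realType) := gen_eqMixin (HQ R).
HB.instance Definition _ (R : realType) := gen_choiceMixin (HQ R).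

Definition d_sup (R : realType) (f g : HQ R) : R :=
  sup [set cmod (f z - g z) | z in disk R].

Section HQ_metric.
Context {R : realType}.
Implicit Types (f g h : HQ R) (z w : C R).

Lemma cmodE z : `|z| = mkC (cmod z) 0.
Proof. by rewrite /cmod /re /mkC normc_def. Qed.

Lemma cmod_ge0 z : 0 <= cmod z.
Proof. by have := normr_ge0 z; rewrite cmodE lecE /= => /andP[]. Qed.

Lemma cmod0 : cmod (0 : C R) = 0.
Proof. by rewrite /cmod normr0. Qed.

Lemma cmodN z : cmod (- z) = cmod z.
Proof. by rewrite /cmod normrN. Qed.

Lemma cmodD z w : cmod (z + w) <= cmod z + cmod w.
Proof. by have := ler_normD z w; rewrite !cmodE lecE /= => /andP[]. Qed.

Lemma cmod_eq0 z : cmod z = 0 -> z = 0.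
Proof. by move=> z0; apply/normr0_eq0; rewrite cmodE z0. Qed.

Lemma HQ_disk f z : disk R z -> disk R (f z).
Proof. by case: (HQ_qc f) => -[g [fD _ _ _ _]] _ _; exact: fD. Qed.

Lemma d_sup_has_sup f g : has_sup [set cmod (f z - g z) | z in disk R].
Proof.
split; first by exists (cmod (f 0 - g 0)), 0 => //; rewrite /disk /= cmod0.
exists 2 => _ [z Dz <-]; rewrite (le_trans (cmodD _ _))// cmodN.
by rewrite -[leRHS]/(1 + 1) lerD// ltW//; exact: HQ_disk.
Qed.

Lemma d_sup_ub f g z : disk R z -> cmod (f z - g z) <= d_sup f g.
Proof.
by move=> Dz; apply: (sup_upper_bound (d_sup_has_sup f g)); exists z.
Qed.

Lemma d_sup_le f g (e : R) :
  (forall z, disk R z -> cmod (f z - g z) <= e) -> d_sup f g <= e.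
Proof.
move=> fg; apply: ge_sup; first by case: (d_sup_has_sup f g).
by move=> _ [z Dz <-]; exact: fg.
Qed.

Lemma HQ_eq f g : (forall z, disk R z -> f z = g z) -> f = g.
Proof.
move=> fg; have {}fg : HQ_fun f = HQ_fun g.
  apply/funext => z; have [Dz|nDz] := pselect (disk R z); first exact: fg.
  by rewrite !HQ_out.
case: f g fg => [f f0 fqc fh] [g g0 gqc gh] /= fg; subst g.
by congr mkHQ; exact: Prop_irrelevance.
Qed.

Lemma d_supxx f : d_sup f f = 0.
Proof.
have D0 : disk R 0 by rewrite /disk /= cmod0.
apply/eqP; rewrite eq_le (le_trans (cmod_ge0 _) (d_sup_ub f f D0)) andbT.
by apply: d_sup_le => z _; rewrite subrr cmod0.
Qed.

Lemma d_sup_positivity f g : d_sup f g = 0 -> f = g.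
Proof.
move=> fg; apply: HQ_eq => z Dz; apply/eqP; rewrite -subr_eq0; apply/eqP.
by apply/cmod_eq0/eqP; rewrite eq_le cmod_ge0 andbT -fg d_sup_ub.
Qed.

Lemma d_sup_sym f g : d_sup f g = d_sup g f.
Proof.
have le f' g' : d_sup f' g' <= d_sup g' f'.
  by apply: d_sup_le => z Dz; rewrite -cmodN opprB; exact: d_sup_ub.
by apply/eqP; rewrite eq_le !le.
Qed.

Lemma d_sup_triangle g f h : d_sup f h <= d_sup f g + d_sup g h.
Proof.
apply: d_sup_le => z Dz; rewrite -(subrKA (g z)).
by rewrite (le_trans (cmodD _ _))// lerD// d_sup_ub.
Qed.

HB.instance Definition _ := @isMetric.Build R (HQ R) (@d_sup R)
  d_supxx d_sup_positivity d_sup_sym d_sup_triangle.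

End HQ_metric.

Definition complete_metric (R : realType) (T : metricType R) : Prop :=
  forall u : nat -> T, cauchy (u @ \oo) -> exists l : T, u @ \oo --> l.

(* Main.v *)
Require Import Defs.
From mathcomp Require Import all_boot all_order all_algebra.
From mathcomp Require Import complex ring lra.
From mathcomp Require Import all_classical all_reals all_analysis.

(** The space is incomplete because of one explicit family.  For [0 <= a] let
<<
      f_a(z) = (1 - a^2) z / (1 - a z^2) - a conj(z),
>>
    the harmonic extension of the self-map
    [(z^2 - a) / ((1 - a z^2) z)] of the unit circle.  The argument of the
    latter moves with speed [2 P - 1], where [P] is a Poisson kernel with
    minimum [(1 - a) / (1 + a)]; this speed is positive for [a < 1/3] and
    vanishes at [i] and [-i] for [a = 1/3].  So [f_a] is quasiconformal as long
    as [a < 1/3], whereas [f_(1/3)] is not.  Since [f_a] depends on [a] in a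
    Lipschitz way, uniformly on the disk ([harm_dist]), any sequence
    [a_n < 1/3] with limit [1/3] gives a Cauchy sequence of [HQ R] that has no
    limit.

    All the estimates come from one identity.  With the divided difference
<<
      M(z,w) = (1 - a^2) (1 + a z w) / ((1 - a z^2) (1 - a w^2))
>>
    of the analytic part of [f_a] ([slope]), one has ([harm_sub])
<<
      f_a(z) - f_a(w) = M(z,w) (z - w) - a conj(z - w),
>>
    and [(1 - a)^2 / (1 + a) <= |M| <= 3] on the closed disk for [a <= 1/3], the
    lower bound being larger than [a] exactly when [a < 1/3].

    - Injectivity and the continuity of the inverse follow, because [f_a] is
      bi-Lipschitz ([harm_lip_low], [harm_lip]); so does absolute continuity on
      lines.
    - Away from the poles, [f_a(z)] is in the disk exactly when [z] is, because
      [1 - |f_a(z)|^2] is [1 - |z|^2] times a positive number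
      ([cmod_den_num]).  Surjectivity is then a minimisation argument: if
      [|f_a - w|] had a positive minimum on the closed disk, moving from the
      minimiser in the direction that the differential maps to [w - f_a]
      would decrease it ([harm_surj]).
    - Along a circle around [z0] the increment [f_a(z) - f_a(z0)] is
      [z - z0] times factors in the right half-plane, which do not wind
      around 0 ([harm_orientation]).
    - The real part of [f_a] is the real part of the holomorphic function
      [h - a z], and its imaginary part is that of [h + a z], where [h] is the
      analytic part; hence [f_a] is harmonic, with [d_z f_a = M(z,z)] and
      [d_zbar f_a = - a] ([harm_wirtinger]).  The dilatation [a / |M(z,z)|] is
      bounded away from 1 if [a < 1/3].  If [a = 1/3], then [|M(i,i)| = a], so
      that near [i] any given bound [k < 1] on the dilatation fails on an open
      set, which is not negligible ([harm_third_not_qc]). *)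

Set Implicit Arguments.
Unset Strict Implicit.
Unset Printing Implicit Defensive.

Import Order.TTheory GRing.Theory Num.Theory.
Import numFieldNormedType.Exports.

Local Open Scope classical_set_scope.
Local Open Scope ring_scope.

(** * The plane: coordinates, modulus, topology *)

Section plane.
Context {R : realType}.
Implicit Types (x y a e : R) (z w : C R).

Lemma mkC_eta z : mkC (re z) (im z) = z. Proof. by case: z. Qed.
Lemma C_eq z w : re z = re w -> im z = im w -> z = w.
Proof. by case: z w => ? ? [? ?] /= -> ->. Qed.
Lemma reD z w : re (z + w) = re z + re w. Proof. by case: z w => ? ? []. Qed.
Lemma imD z w : im (z + w) = im z + im w. Proof. by case: z w => ? ? []. Qed.
Lemma reN z : re (- z) = - re z. Proof. by case: z. Qed.
Lemma imN z : im (- z) = - im z. Proof. by case: z. Qed.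
Lemma reM z w : re (z * w) = re z * re w - im z * im w.
Proof. by case: z w => ? ? []. Qed.
Lemma imM z w : im (z * w) = re z * im w + im z * re w.
Proof. by case: z w => ? ? []. Qed.
Lemma re1 : re (1 : C R) = 1. Proof. by []. Qed.
Lemma im1 : im (1 : C R) = 0. Proof. by []. Qed.
Lemma re0 : re (0 : C R) = 0. Proof. by []. Qed.
Lemma im0 : im (0 : C R) = 0. Proof. by []. Qed.
Lemma re_mkC x y : re (mkC x y) = x. Proof. by []. Qed.
Lemma im_mkC x y : im (mkC x y) = y. Proof. by []. Qed.
Lemma re_conj z : re (z^*) = re z. Proof. by case: z. Qed.
Lemma im_conj z : im (z^*) = - im z. Proof. by case: z. Qed.

(** Rewriting with [CE] reduces an identity of complex numbers, taken
    coordinatewise, to a polynomial identity of reals. *)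
Definition CE := (reM, imM, reD, imD, reN, imN, re_conj, im_conj,
  re1, im1, re0, im0, re_mkC, im_mkC).

Lemma cmodM z w : cmod (z * w) = cmod z * cmod w.
Proof. by rewrite {1}/cmod normrM !cmodE CE mulr0 subr0. Qed.
Lemma cmod1 : cmod (1 : C R) = 1. Proof. by rewrite /cmod normr1. Qed.
Lemma cmodV z : cmod z^-1 = (cmod z)^-1.
Proof.
have [->|z0] := eqVneq z 0; first by rewrite invr0 cmod0 invr0.
have cz0 : cmod z != 0 by apply: contra_neq z0; exact: cmod_eq0.
by apply: (mulfI cz0); rewrite -cmodM !divff ?cmod1.
Qed.
Lemma cmod_sqr z : cmod z ^+ 2 = re z ^+ 2 + im z ^+ 2.
Proof.
rewrite /cmod normc_def /re /=; case: z => x y /=.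
by rewrite sqr_sqrtr// addr_ge0// sqr_ge0.
Qed.
Lemma cmod_conj z : cmod z^* = cmod z.
Proof.
by apply/eqP; rewrite -(eqrXn2 (n:=2))// ?cmod_ge0// !cmod_sqr !CE sqrrN.
Qed.
Lemma cmod_re z : `|re z| <= cmod z.
Proof.
rewrite -(@ler_pXn2r _ 2)// ?nnegrE ?cmod_ge0//.
by rewrite cmod_sqr real_normK ?num_real// lerDl sqr_ge0.
Qed.
Lemma cmod_im z : `|im z| <= cmod z.
Proof.
rewrite -(@ler_pXn2r _ 2)// ?nnegrE ?cmod_ge0//.
by rewrite cmod_sqr real_normK ?num_real// lerDr sqr_ge0.
Qed.
Lemma cmod_real x : cmod (mkC x 0) = `|x|.
Proof.
apply/eqP; rewrite -(eqrXn2 (n := 2))// ?cmod_ge0// cmod_sqr !CE.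
by rewrite real_normK ?num_real// expr0n addr0.
Qed.
Lemma cmod_imag x : cmod (mkC 0 x) = `|x|.
Proof.
apply/eqP; rewrite -(eqrXn2 (n := 2))// ?cmod_ge0// cmod_sqr !CE.
by rewrite real_normK ?num_real// expr0n add0r.
Qed.
Lemma cmodB z w : cmod (z - w) = cmod (w - z).
Proof. by rewrite -cmodN opprB. Qed.
Lemma cmod_le x y e : 0 <= e -> (cmod (mkC x y) <= e) = (x ^+ 2 + y ^+ 2 <= e ^+ 2).
Proof. by move=> e0; rewrite -(@ler_pXn2r _ 2)// ?nnegrE ?cmod_ge0// cmod_sqr. Qed.

Lemma cmod_ge_sub z w : cmod z - cmod w <= cmod (z + w).
Proof. by have := cmodD (z + w) (- w); rewrite addrK cmodN; lra. Qed.

(** Balls of [C R] have radii in [C R] itself, which is only partially ordered; this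
    lemma and the next restate the topology with real radii. *)
Lemma nbhs_cmod z (A : set (C R)) :
  nbhs z A <-> exists2 e : R, 0 < e & forall w, cmod (w - z) < e -> A w.
Proof.
split.
  move=> /nbhs_ballP[e /= e0 eA].
  have e0' : 0 < re e by move: e0; rewrite ltcE /= => /andP[].
  exists (re e) => // w wz; apply: eA; rewrite /ball /= distrC.
  rewrite cmodE ltcE /= wz andbT.
  by move: e0; rewrite ltcE /= => /andP[/eqP ->].
move=> [e e0 eA]; apply/nbhs_ballP; exists (mkC e 0).
  by rewrite /= ltcE /= eqxx.
by move=> w; rewrite /ball /= distrC cmodE ltcE /= eqxx /= => /eA.
Qed.

Lemma cvg_cmod (T : Type) (F : set_system T) (FF : Filter F) (u : T -> C R) z :
  u @ F --> z <-> forall e : R, 0 < e -> \forall t \near F, cmod (u t - z) < e.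
Proof.
split.
  move=> uz e e0; apply: (uz [set w | cmod (w - z) < e]).
  by apply/nbhs_cmod; exists e.
move=> uz A /nbhs_cmod[e e0 eA]; apply: filterS (uz _ e0) => t; exact: eA.
Qed.

Lemma contraction_continuous (u : C R -> R) :
  (forall z w, `|u z - u w| <= cmod (z - w)) -> continuous u.
Proof.
move=> uP z; apply/(@cvgrPdist_lt R R^o _ (nbhs z) _ u) => e e0.
apply/nbhs_cmod; exists e => // w wz.
by apply: le_lt_trans wz; rewrite cmodB.
Qed.

Lemma re_continuous : continuous (re : C R -> R).
Proof. by apply: contraction_continuous => z w; rewrite -reN -reD cmod_re. Qed.
Lemma im_continuous : continuous (im : C R -> R).
Proof. by apply: contraction_continuous => z w; rewrite -imN -imD cmod_im. Qed.
Lemma cmod_continuous : continuous (cmod : C R -> R).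
Proof.
apply: contraction_continuous => z w; rewrite ler_norml.
have := cmodD (w - z) z; have := cmodD (z - w) w; rewrite !subrK (cmodB w z).
by move=> ? ?; lra.
Qed.
Lemma cmod_mkC_le x y : cmod (mkC x y) <= `|x| + `|y|.
Proof.
rewrite -(@ler_pXn2r _ 2)// ?nnegrE ?cmod_ge0 ?addr_ge0// cmod_sqr sqrrD.
rewrite !real_normK ?num_real// !CE.
have : 0 <= `|x| * `|y| by rewrite mulr_ge0.
by move=> ?; lra.
Qed.
Lemma mkC_cvg (T : Type) (F : set_system T) (FF : Filter F) (u v : T -> R) x y :
  u @ F --> x -> v @ F --> y -> (fun t => mkC (u t) (v t)) @ F --> mkC x y.
Proof.
move=> /cvgrPdist_lt ux /cvgrPdist_lt vy; apply/cvg_cmod => e e0.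
have e20 : 0 < e / 2 by rewrite divr_gt0.
near=> t.
rewrite (_ : mkC (u t) (v t) - mkC x y = mkC (u t - x) (v t - y)); last exact: C_eq.
apply: le_lt_trans (cmod_mkC_le _ _) _; rewrite (splitr e) ltrD//.
- by rewrite distrC; near: t; exact: ux.
- by rewrite distrC; near: t; exact: vy.
Unshelve. all: by end_near. Qed.

Lemma disk_nbhs z : disk R z -> nbhs z (disk R).
Proof.
move=> zD; apply/nbhs_cmod; exists (1 - cmod z); first by rewrite subr_gt0.
move=> w wz; rewrite /disk /=; have := cmodD (w - z) z; rewrite subrK; lra.
Qed.

Lemma closed_disk_compact : compact [set z : C R | cmod z <= 1].
Proof.
apply: (@subclosed_compact _ _ ((fun p : R * R => mkC p.1 p.2) @` (`[-1, 1] `*` `[-1, 1]))).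
- rewrite (_ : [set _ | _] = cmod @^-1` [set x : R | x <= 1])//.
  by apply: closed_comp => [z _|]; [exact: cmod_continuous|exact: closed_le].
- apply: continuous_compact; last by apply: compact_setX; exact: segment_compact.
  apply: continuous_subspaceT => p; apply: mkC_cvg; [exact: cvg_fst|exact: cvg_snd].
- move=> z z1 /=; exists (re z, im z) => /=; last exact: mkC_eta.
  by split; rewrite /= in_itv /= -ler_norml (le_trans _ z1)// ?cmod_re ?cmod_im.
Qed.

End plane.

(** * Continuity of maps into the plane *)

(** The rules of calculus for continuity at a point, with pointwise operations
    written out so that they apply to explicit formulas. *)
Section complex_continuity.
Context {R : realType} {T : topologicalType}.
Implicit Types (u v : T -> C R) (t : T).
Lemma contD t u v : {for t, continuous u} -> {for t, continuous v} ->
  {for t, continuous (fun s => u s + v s)}.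
Proof. exact: (@continuousD (C R) (C R) T u v t). Qed.
Lemma contM t u v : {for t, continuous u} -> {for t, continuous v} ->
  {for t, continuous (fun s => u s * v s)}.
Proof. exact: (@continuousM (C R) T u v t). Qed.
Lemma contN t u : {for t, continuous u} -> {for t, continuous (fun s => - u s)}.
Proof. exact: (@continuousN (C R) (C R) T u t). Qed.
Lemma contV t u : u t != 0 -> {for t, continuous u} ->
  {for t, continuous (fun s => (u s)^-1)}.
Proof. exact: (@continuousV (C R) T u t). Qed.
Lemma cont_cst t (a : C R) : {for t, continuous (fun _ : T => a)}.
Proof. exact: cst_continuous. Qed.
Lemma re_comp t (m : T -> C R) : {for t, continuous m} ->
  {for t, continuous (fun s => re (m s))}.
Proof. move=> cm; exact: (cvg_comp _ _ cm (@re_continuous R (m t))). Qed.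
Lemma im_comp t (m : T -> C R) : {for t, continuous m} ->
  {for t, continuous (fun s => im (m s))}.
Proof. move=> cm; exact: (cvg_comp _ _ cm (@im_continuous R (m t))). Qed.
Lemma cmod_comp t (m : T -> C R) : {for t, continuous m} ->
  {for t, continuous (fun s => cmod (m s))}.
Proof. move=> cm; exact: (cvg_comp _ _ cm (@cmod_continuous R (m t))). Qed.
End complex_continuity.

Lemma cont_id {R : realType} (z : C R) : {for z, continuous (fun w : C R => w)}.
Proof. exact: cvg_id. Qed.

Lemma near_eq_cvg_to {T U : topologicalType} (x : T) (u v : T -> U) (l : U) :
  (\forall t \near x, u t = v t) -> u t @[t --> x] --> l -> v t @[t --> x] --> l.
Proof. by move=> uv; apply: cvg_trans; apply: near_eq_cvg; apply: filterS uv => t. Qed.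

Lemma cont_near_neq0 {R : realType} {T : topologicalType} (t : T) (u : T -> C R) :
  {for t, continuous u} -> u t != 0 -> \forall s \near t, u s != 0.
Proof.
move=> cu ut0; apply: (cu [set z | z != 0]); apply/nbhs_cmod.
exists (cmod (u t)).
  by rewrite lt_def cmod_ge0 andbT; apply: contra_neq ut0; exact: cmod_eq0.
by move=> w; apply: contraPneq => ->; rewrite sub0r cmodN ltxx.
Qed.

(** * Complex derivatives, partial derivatives and harmonicity *)

Section complex_derivative.
Context {R : realType}.
Implicit Types (x y a e : R) (z w c l : C R) (h g : C R -> C R) (u : C R -> R).

(** Caratheodory's form of differentiability: the difference quotient extends
    continuously to [z].  It makes the rules for products and inverses
    algebraic, and restricts well to horizontal and vertical lines. *)
Definition complex_derive z h l := exists m : C R -> C R,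
  [/\ \forall w \near z, h w - h z = m w * (w - z), {for z, continuous m} & m z = l].

Lemma complex_derive_continuous z h l : complex_derive z h l -> {for z, continuous h}.
Proof.
move=> [m [hm cm _]].
have H : {for z, continuous (fun w => m w * (w - z) + h z)}.
  apply: contD; last exact: cont_cst.
  apply: contM; first exact: cm.
  by apply: contD; [exact: cont_id|exact: cont_cst].
have {}H : (m w * (w - z) + h z) @[w --> z] --> h z.
  by rewrite -[X in _ --> X](_ : m z * (z - z) + h z = h z)// subrr mulr0 add0r.
have E : \forall w \near z, m w * (w - z) + h z = h w.
  near=> w; apply/eqP; rewrite eq_sym -subr_eq; apply/eqP; near: w; exact: hm.
exact: (near_eq_cvg_to E H).
Unshelve. all: by end_near. Qed.

Lemma complex_derive_id z : complex_derive z id 1.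
Proof.
exists (cst 1); split=> //; last exact: cont_cst.
by near=> w; rewrite mul1r.
Unshelve. all: by end_near. Qed.

Lemma complex_derive_cst z c : complex_derive z (cst c) 0.
Proof.
exists (cst 0); split=> //; last exact: cont_cst.
by near=> w; rewrite mul0r subrr.
Unshelve. all: by end_near. Qed.

Lemma complex_deriveD z h g l k : complex_derive z h l -> complex_derive z g k ->
  complex_derive z (fun w => h w + g w) (l + k).
Proof.
move=> [m [hm cm <-]] [n [hn cn <-]]; exists (fun w => m w + n w); split; last by [].
- near=> w; rewrite mulrDl opprD addrACA; congr (_ + _); near: w; [exact: hm|exact: hn].
- by apply: contD; [exact: cm|exact: cn].
Unshelve. all: by end_near. Qed.

Lemma complex_deriveM z h g l k : complex_derive z h l -> complex_derive z g k ->
  complex_derive z (fun w => h w * g w) (l * g z + h z * k).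
Proof.
move=> hd; have ch := complex_derive_continuous hd.
move: hd => [m [hm cm <-]] [n [hn cn <-]].
exists (fun w => m w * g z + h w * n w); split; last by [].
- near=> w.
  have hw : h w - h z = m w * (w - z) by near: w; exact: hm.
  have gw : g w - g z = n w * (w - z) by near: w; exact: hn.
  by rewrite mulrDl mulrAC -hw -mulrA -gw; ring.
- apply: contD; first by apply: contM; [exact: cm|exact: cont_cst].
  by apply: contM; [exact: ch|exact: cn].
Unshelve. all: by end_near. Qed.

Lemma complex_deriveZ z h l c : complex_derive z h l ->
  complex_derive z (fun w => c * h w) (c * l).
Proof.
move=> hd; rewrite -[c * l]add0r -(mul0r (h z)).
exact: complex_deriveM (complex_derive_cst _ _) hd.
Qed.

Lemma complex_deriveV z h l : h z != 0 -> complex_derive z h l ->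
  complex_derive z (fun w => (h w)^-1) (- l / h z ^+ 2).
Proof.
move=> hz0 hd; have ch := complex_derive_continuous hd.
move: hd => [m [hm cm <-]].
exists (fun w => - m w / (h w * h z)); split; last by [].
- near=> w.
  have hw : h w - h z = m w * (w - z) by near: w; exact: hm.
  have hw0 : h w != 0 by near: w; exact: cont_near_neq0 ch hz0.
  by rewrite mulrAC mulNr -hw; field; rewrite hz0 hw0.
- apply: contM; first by apply: contN; exact: cm.
  by apply: contV; [rewrite mulf_neq0|apply: contM; [exact: ch|exact: cont_cst]].
Unshelve. all: by end_near. Qed.

Definition is_partials z u (p q : R) :=
  is_derive (re z : R) (1 : R) (fun t : R => u (mkC t (im z))) p /\
  is_derive (im z : R) (1 : R) (fun t : R => u (mkC (re z) t)) q.

Lemma line_x_continuous z : (fun t : R => mkC t (im z)) t @[t --> re z] --> z.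
Proof.
have := @mkC_cvg R R (nbhs (re z)) _ id (cst (im z)) (re z) (im z) cvg_id (cvg_cst _).
rewrite mkC_eta => H; exact: H.
Qed.
Lemma line_y_continuous z : (fun t : R => mkC (re z) t) t @[t --> im z] --> z.
Proof.
have := @mkC_cvg R R (nbhs (im z)) _ (cst (re z)) id (re z) (im z) (cvg_cst _) cvg_id.
rewrite mkC_eta => H; exact: H.
Qed.

Lemma line_x_comp (V : topologicalType) z (m : C R -> V) : {for z, continuous m} ->
  {for re z : R, continuous (fun t : R => m (mkC t (im z)))}.
Proof.
move=> cm; have H : m (mkC t (im z)) @[t --> re z] --> m (mkC (re z) (im z)).
  rewrite mkC_eta; exact: (cvg_comp _ _ (@line_x_continuous z) cm).
exact: H.
Qed.
Lemma line_y_comp (V : topologicalType) z (m : C R -> V) : {for z, continuous m} ->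
  {for im z : R, continuous (fun t : R => m (mkC (re z) t))}.
Proof.
move=> cm; have H : m (mkC (re z) t) @[t --> im z] --> m (mkC (re z) (im z)).
  rewrite mkC_eta; exact: (cvg_comp _ _ (@line_y_continuous z) cm).
exact: H.
Qed.
Lemma is_derive_near_caratheodory (phi m : R -> R) x :
  (\forall t \near x, phi t - phi x = m t * (t - x)) -> {for x, continuous m} ->
  is_derive x 1 phi (m x).
Proof.
move=> pm cm.
apply: (@near_eq_is_derive _ _ _ (fun t => phi x + m t * (t - x))).
  by near=> t; apply/eqP; rewrite addrC eq_sym -subr_eq; apply/eqP; near: t.
apply/is_derive1_caratheodory; exists m; split=> // t.
by rewrite subrr mulr0 addr0 addrAC subrr add0r.
Unshelve. all: by end_near. Qed.

(** The Cauchy-Riemann equations, as formulas for the partial derivatives of the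
    real part: restrict the difference quotient to the two coordinate lines
    through [z], where [w - z] is real and purely imaginary respectively. *)
Lemma complex_derive_partials z h l : complex_derive z h l ->
  is_partials z (re \o h) (re l) (- im l).
Proof.
move=> [m [hm cm <-]]; split.
- rewrite -{3}(mkC_eta z).
  apply: (@is_derive_near_caratheodory _ (fun t => re (m (mkC t (im z))))).
    near=> t; rewrite /= mkC_eta -reN -reD.
    have -> : h (mkC t (im z)) - h z = m (mkC t (im z)) * (mkC t (im z) - z).
      by near: t; exact: (line_x_continuous hm).
    by rewrite reM !CE subrr mulr0 subr0.
  exact: (line_x_comp (re_comp cm)).
- rewrite -{3}(mkC_eta z).
  apply: (@is_derive_near_caratheodory _ (fun t => - im (m (mkC (re z) t)))).
    near=> t; rewrite /= mkC_eta -reN -reD.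
    have -> : h (mkC (re z) t) - h z = m (mkC (re z) t) * (mkC (re z) t - z).
      by near: t; exact: (line_y_continuous hm).
    by rewrite reM !CE subrr mulr0 add0r mulNr.
  exact: (continuousN (line_y_comp (im_comp cm))).
Unshelve. all: by end_near. Qed.

Lemma is_partials_near u v z p q : (\forall w \near z, u w = v w) ->
  is_partials z u p q -> is_partials z v p q.
Proof.
move=> uv [up uq]; split.
- apply: near_eq_is_derive up; exact: (line_x_continuous uv).
- apply: near_eq_is_derive uq; exact: (line_y_continuous uv).
Qed.

Lemma is_partialsE z u p q : is_partials z u p q ->
  [/\ has_partials u z, partial_x u z = p & partial_y u z = q].
Proof.
by move=> [[dx ex] [dy ey]]; split; rewrite ?/partial_x ?/partial_y ?derive1E.
Qed.

(** As [A] is open, [partial_x u] and [partial_y u] agree near each point of [A]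
    with the continuous functions [p] and [q]. *)
Lemma C1_on_partials (A : set (C R)) u (p q : C R -> R) :
  (forall z, A z -> nbhs z A) ->
  (forall z, A z -> is_partials z u (p z) (q z)) ->
  (forall z, A z -> {for z, continuous p}) ->
  (forall z, A z -> {for z, continuous q}) ->
  C1_on A u.
Proof.
move=> oA upq cp cq; split.
- by move=> z /upq/is_partialsE[].
- move=> z; rewrite inE => Az; rewrite /continuous_at.
  have [_ -> _] := is_partialsE (upq _ Az).
  have E : \forall w \near z, p w = partial_x u w.
    near=> w; have /upq/is_partialsE[] : A w by near: w; exact: oA.
    by move=> _ ? ?.
  exact: (near_eq_cvg_to E (cp _ Az)).
- move=> z; rewrite inE => Az; rewrite /continuous_at.
  have [_ _ ->] := is_partialsE (upq _ Az).
  have E : \forall w \near z, q w = partial_y u w.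
    near=> w; have /upq/is_partialsE[] : A w by near: w; exact: oA.
    by move=> _ ? ?.
  exact: (near_eq_cvg_to E (cq _ Az)).
Unshelve. all: by end_near. Qed.

(** By the Cauchy-Riemann equations [u_xx = re h2] and [u_yy = - re h2].  The
    imaginary part of [h] is also covered, as the real part of [- i h]. *)
Lemma re_holomorphic_harmonic (A : set (C R)) h h1 h2 u :
  (forall z, A z -> nbhs z A) ->
  (forall z, A z -> complex_derive z h (h1 z)) ->
  (forall z, A z -> complex_derive z h1 (h2 z)) ->
  (forall z, A z -> {for z, continuous h2}) ->
  (forall z, A z -> u z = re (h z)) ->
  real_harmonic_on A u.
Proof.
move=> oA dh dh1 ch2 uh.
have near_A P : (forall z, A z -> P z) -> forall z, A z -> \forall w \near z, P w.
  by move=> AP z /oA; apply: filterS.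
have creh (k : C R -> C R) : (forall z, A z -> {for z, continuous k}) ->
    forall z, A z -> {for z, continuous (re \o k)}.
  by move=> ck z Az; exact: (re_comp (ck _ Az)).
have cimh (k : C R -> C R) : (forall z, A z -> {for z, continuous k}) ->
    forall z, A z -> {for z, continuous (im \o k)}.
  by move=> ck z Az; exact: (im_comp (ck _ Az)).
have cnimh (k : C R -> C R) : (forall z, A z -> {for z, continuous k}) ->
    forall z, A z -> {for z, continuous (fun w => - im (k w))}.
  by move=> ck z Az; exact: (continuousN (cimh _ ck _ Az)).
have ch1 z (Az : A z) := complex_derive_continuous (dh1 _ Az).
have pu z : A z -> is_partials z u (re (h1 z)) (- im (h1 z)).
  move=> Az; apply: is_partials_near (complex_derive_partials (dh _ Az)).
  by apply: (near_A _ _ _ Az) => w /uh.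
have pux z : A z -> is_partials z (partial_x u) (re (h2 z)) (- im (h2 z)).
  move=> Az; apply: is_partials_near (complex_derive_partials (dh1 _ Az)).
  by apply: (near_A _ _ _ Az) => w /pu/is_partialsE[].
have puy z : A z -> is_partials z (partial_y u) (- im (h2 z)) (- re (h2 z)).
  (* [- im h1] is the real part of [i h1] *)
  move=> Az; have := complex_derive_partials (complex_deriveZ (mkC 0 1) (dh1 _ Az)).
  have -> : re (mkC 0 1 * h2 z) = - im (h2 z) by rewrite !CE; ring.
  have -> : im (mkC 0 1 * h2 z) = re (h2 z) by rewrite !CE; ring.
  move=> H.
  apply: is_partials_near H; apply: (near_A _ _ _ Az) => w /pu/is_partialsE[_ _ ->] /=.
  by rewrite !CE; ring.
split; last first.
  move=> z Az; rewrite /laplacian.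
  have [_ -> _] := is_partialsE (pux _ Az); have [_ _ ->] := is_partialsE (puy _ Az).
  by rewrite subrr.
split.
- exact: (C1_on_partials oA pu (creh _ ch1) (cnimh _ ch1)).
- exact: (C1_on_partials oA pux (creh _ ch2) (cnimh _ ch2)).
- apply: (C1_on_partials oA puy (cnimh _ ch2)) => z Az.
  exact: (continuousN (creh _ ch2 _ Az)).
Qed.

End complex_derivative.

(** * The maps f_a and their divided differences *)

Definition cst_of {R : realType} (a : R) : C R := mkC a 0.
Local Notation "a %:c" := (cst_of a) (at level 2, format "a %:c").

Section family.
Context {R : realType}.
Implicit Types (z w : C R).

Lemma cst_of_conj (a : R) : (a%:c)^* = a%:c.
Proof. by apply: C_eq; rewrite !CE ?oppr0. Qed.

Definition den (a : R) z : C R := 1 - a%:c * (z * z).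
Definition hol (a : R) z : C R := (1 - a%:c * a%:c) * z / den a z.
(** The divided difference of [hol a]; on the diagonal it is the derivative of
    [hol a]. *)
Definition slope (a : R) z w : C R :=
  (1 - a%:c * a%:c) * (1 + a%:c * (z * w)) / (den a z * den a w).
Definition harm (a : R) z : C R := hol a z - a%:c * z^*.

Definition closed_disk : set (C R) := [set z | cmod z <= 1].

Context (a : R) (a_ge0 : 0 <= a) (a_le : a <= 3^-1).

Lemma disk_closed z : disk R z -> closed_disk z. Proof. exact: ltW. Qed.

Lemma cmod_cst : cmod a%:c = a.
Proof. by rewrite cmod_real ger0_norm. Qed.

Lemma cmod_mul_le z w : closed_disk z -> closed_disk w -> cmod (a%:c * (z * w)) <= a.
Proof.
rewrite /closed_disk /= => z1 w1; rewrite !cmodM cmod_cst -[leRHS]mulr1.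
by apply: ler_pM => //; rewrite ?mulr_ge0 ?cmod_ge0// -[leRHS]mulr1 ler_pM ?cmod_ge0.
Qed.

Lemma cmod_1D z w : closed_disk z -> closed_disk w ->
  1 - a <= cmod (1 + a%:c * (z * w)) <= 1 + a.
Proof.
move=> z1 w1; have := cmod_mul_le z1 w1 => e.
have := cmod_ge_sub 1 (a%:c * (z * w)); have := cmodD 1 (a%:c * (z * w)).
by rewrite cmod1 => ? ?; apply/andP; split; lra.
Qed.

Lemma cmod_den z : closed_disk z -> 1 - a <= cmod (den a z) <= 1 + a.
Proof.
move=> z1; have := cmod_mul_le z1 z1 => e.
have := cmod_ge_sub 1 (- (a%:c * (z * z))); have := cmodD 1 (- (a%:c * (z * z))).
by rewrite cmodN cmod1 => ? ?; apply/andP; split; rewrite /den; lra.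
Qed.

Lemma den_neq0 z : closed_disk z -> den a z != 0.
Proof.
move=> /cmod_den/andP[d _]; apply/eqP => d0; move: d; rewrite d0 cmod0.
by move: a_le; lra.
Qed.

Lemma cmod_slope z w : cmod (slope a z w) =
  (1 - a ^+ 2) * cmod (1 + a%:c * (z * w)) / (cmod (den a z) * cmod (den a w)).
Proof.
rewrite /slope cmodM cmodV !cmodM; congr (_ * _ / _).
rewrite (_ : 1 - _ = (1 - a ^+ 2)%:c) ?cmod_real ?ger0_norm//.
  by move: a_ge0 a_le; nra.
by apply: C_eq; rewrite !CE; ring.
Qed.

(** Attained at [z = w = i], where all three factors of [slope] are extremal. *)
Lemma cmod_slope_ge z w : closed_disk z -> closed_disk w ->
  (1 - a) ^+ 2 / (1 + a) <= cmod (slope a z w).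
Proof.
move=> z1 w1; have /andP[n0 n1] := cmod_1D z1 w1.
have /andP[d0 d1] := cmod_den z1; have /andP[e0 e1] := cmod_den w1.
rewrite cmod_slope.
have a1 : 0 < 1 + a by move: a_ge0; lra.
have a2 : 0 < 1 - a by move: a_le; lra.
have p0 : 0 < cmod (den a z) * cmod (den a w) by apply: mulr_gt0; lra.
rewrite ler_pdivlMr// mulrAC ler_pdivrMr//.
have -> : 1 - a ^+ 2 = (1 - a) * (1 + a) by ring.
apply: (@le_trans _ _ ((1 - a) ^+ 2 * ((1 + a) * (1 + a)))).
  rewrite ler_wpM2l ?sqr_ge0//; apply: ler_pM; lra.
have -> : (1 - a) ^+ 2 * ((1 + a) * (1 + a)) = (1 - a) * (1 + a) * (1 - a) * (1 + a) by ring.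
apply: ler_wpM2r; first exact: ltW.
by apply: ler_wpM2l => //; rewrite ltW// mulr_gt0.
Qed.

Lemma cmod_slope_le z w : closed_disk z -> closed_disk w -> cmod (slope a z w) <= 3.
Proof.
move=> z1 w1; have /andP[n0 n1] := cmod_1D z1 w1.
have /andP[d0 d1] := cmod_den z1; have /andP[e0 e1] := cmod_den w1.
rewrite cmod_slope.
have a1 : 0 < 1 + a by move: a_ge0; lra.
have a2 : 0 < 1 - a by move: a_le; lra.
have p0 : 0 < cmod (den a z) * cmod (den a w) by apply: mulr_gt0; lra.
rewrite ler_pdivrMr//.
apply: (@le_trans _ _ (3 * ((1 - a) * (1 - a)))); last first.
  by rewrite ler_wpM2l//; apply: ler_pM; lra.
apply: (@le_trans _ _ ((1 - a ^+ 2) * (1 + a))).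
  by rewrite ler_wpM2l//; move: a_ge0 a_le; nra.
have -> : (1 - a ^+ 2) * (1 + a) = (1 - a) * ((1 + a) * (1 + a)) by ring.
have -> : 3 * ((1 - a) * (1 - a)) = (1 - a) * (3 * (1 - a)) by ring.
apply: ler_wpM2l; first exact: ltW.
by move: a_ge0 a_le; nra.
Qed.

Lemma harm_sub z w : den a z != 0 -> den a w != 0 ->
  harm a z - harm a w = slope a z w * (z - w) - a%:c * (z - w)^*.
Proof.
move=> dz dw; rewrite rmorphB /harm /hol /slope /=.
move: dz dw; rewrite /den => dz dw.
by field; rewrite dz dw.
Qed.

(** The lower bound of [|slope|] minus [a]; it equals [(1 - 3 a) / (1 + a)]. *)
Definition lip_low := (1 - a) ^+ 2 / (1 + a) - a.

Lemma lip_low_gt0 : a < 3^-1 -> 0 < lip_low.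
Proof.
move=> a3; rewrite subr_gt0 ltr_pdivlMr; last by move: a_ge0; lra.
by move: a_ge0; nra.
Qed.

Lemma harm_lip_low z w : closed_disk z -> closed_disk w ->
  lip_low * cmod (z - w) <= cmod (harm a z - harm a w).
Proof.
move=> z1 w1; rewrite harm_sub ?den_neq0//.
have := cmod_ge_sub (slope a z w * (z - w)) (- (a%:c * (z - w)^*)).
rewrite cmodN (cmodM (slope a z w)) (cmodM a%:c) cmod_conj cmod_cst; apply: le_trans.
rewrite -mulrBl ler_wpM2r ?cmod_ge0// /lip_low lerD2r. exact: cmod_slope_ge.
Qed.

Lemma harm_lip z w : closed_disk z -> closed_disk w ->
  cmod (harm a z - harm a w) <= 4 * cmod (z - w).
Proof.
move=> z1 w1; rewrite harm_sub ?den_neq0//.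
apply: le_trans (cmodD _ _) _.
rewrite cmodN (cmodM (slope a z w)) (cmodM a%:c) cmod_conj cmod_cst -mulrDl.
rewrite ler_wpM2r ?cmod_ge0//.
by have := cmod_slope_le z1 w1; move: a_le; lra.
Qed.

(** The numerator of [harm a z] over the denominator [den a z]. *)
Definition num z : C R := z * (1 - a%:c * a%:c) - a%:c * (z^* * den a z).

Lemma harm_num z : den a z != 0 -> harm a z = num z / den a z.
Proof. by move=> dz; rewrite /harm /hol /num; field. Qed.

(** As [harm a = num / den], this says that [1 - |f_a|^2] and [1 - |z|^2] have the
    same sign, also outside of the disk, and in particular that [f_a] maps the
    circle to itself. *)
Lemma cmod_den_num z : exists2 E : R, 0 < E &
  cmod (den a z) ^+ 2 - cmod (num z) ^+ 2 = (1 - cmod z ^+ 2) * E.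
Proof.
rewrite !cmod_sqr /num /den !CE; set x := re z; set y := im z.
pose r := x ^+ 2 + y ^+ 2.
(* this factor is at least [1 + a^2 r (1 - a^2 - 2 a)] *)
exists (1 + a ^+ 2 * r - a ^+ 4 * r * (1 - r) - 2 * a ^+ 3 * (x ^+ 2 - y ^+ 2)); last first.
  by rewrite /r; ring.
have r0 : 0 <= r by rewrite addr_ge0// sqr_ge0.
have rr0 : 0 <= a ^+ 4 * r ^+ 2 by rewrite mulr_ge0// ?exprn_ge0.
have ay : 0 <= a ^+ 3 * y ^+ 2 by rewrite mulr_ge0 ?sqr_ge0 ?exprn_ge0.
have : 0 <= (a ^+ 2 * r) * (1 - a ^+ 2 - 2 * a).
  apply: mulr_ge0; first by rewrite mulr_ge0// sqr_ge0.
  by move: a_ge0 a_le; nra.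
have -> : a ^+ 2 * r * (1 - a ^+ 2 - 2 * a) = a ^+ 2 * r - a ^+ 4 * r - 2 * a ^+ 3 * r by ring.
have -> : x ^+ 2 - y ^+ 2 = r - 2 * y ^+ 2 by rewrite /r; ring.
move=> H; lra.
Qed.

Lemma harm_disk z : den a z != 0 -> (cmod (harm a z) < 1) = (cmod z < 1).
Proof.
move=> dz; have [E E0 HE] := cmod_den_num z.
have d0 : 0 < cmod (den a z).
  by rewrite lt_def cmod_ge0 andbT; apply: contra_neq dz; exact: cmod_eq0.
rewrite harm_num// cmodM cmodV ltr_pdivrMr// mul1r.
rewrite -(@ltr_pXn2r _ 2)// ?nnegrE ?cmod_ge0//.
rewrite -[in RHS](@ltr_pXn2r _ 2)// ?nnegrE ?cmod_ge0//.
by rewrite -subr_gt0 HE pmulr_lgt0// expr1n subr_gt0.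
Qed.

Lemma harm_closed_disk z : closed_disk z -> closed_disk (harm a z).
Proof.
move=> z1; have dz := den_neq0 z1; have [E E0 HE] := cmod_den_num z.
have d0 : 0 < cmod (den a z).
  by rewrite lt_def cmod_ge0 andbT; apply: contra_neq dz; exact: cmod_eq0.
rewrite /closed_disk /= harm_num// cmodM cmodV ler_pdivrMr// mul1r.
rewrite -(@ler_pXn2r _ 2)// ?nnegrE ?cmod_ge0//.
by rewrite -subr_ge0 HE mulr_ge0 ?(ltW E0)// subr_ge0 expr_le1// cmod_ge0.
Qed.

End family.

(** * f_a is a homeomorphism of the disk for a < 1/3 *)

Section continuity.
Context {R : realType} {T : topologicalType}.
Implicit Types (u v : T -> C R) (t : T).

Lemma conj_cont t u : {for t, continuous u} -> {for t, continuous (fun s => (u s)^*)}.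
Proof.
move=> cu; apply/cvg_cmod => e e0.
have /cvg_cmod/(_ _ e0) H : u s @[s --> t] --> u t by exact: cu.
by apply: filterS H => s; rewrite -rmorphB cmod_conj.
Qed.

Lemma cst_of_cont t (f : T -> R) : {for t, continuous f} ->
  {for t, continuous (fun s => (f s)%:c)}.
Proof.
move=> cf; apply/cvg_cmod => e e0.
have /cvgrPdist_lt/(_ _ e0) H : f s @[s --> t] --> f t by exact: cf.
apply: filterS H => s; rewrite (_ : _ - _ = (f s - f t)%:c) ?cmod_real 1?distrC//.
by apply: C_eq; rewrite !CE ?subrr.
Qed.

Lemma den_cont a t u : {for t, continuous u} -> {for t, continuous (fun s => den a (u s))}.
Proof.
move=> cu; apply: contD; first exact: cont_cst.
apply: contN; apply: contM; first exact: cont_cst.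
by apply: contM; exact: cu.
Qed.

Lemma slope_cont a t u v : den a (u t) != 0 -> den a (v t) != 0 ->
  {for t, continuous u} -> {for t, continuous v} ->
  {for t, continuous (fun s => slope a (u s) (v s))}.
Proof.
move=> du dv cu cv; apply: contM.
  apply: contM; first exact: cont_cst.
  apply: contD; first exact: cont_cst.
  apply: contM; first exact: cont_cst.
  by apply: contM; [exact: cu|exact: cv].
apply: contV; first by rewrite mulf_neq0.
by apply: contM; apply: den_cont; [exact: cu|exact: cv].
Qed.

Lemma harm_cont a t u : den a (u t) != 0 ->
  {for t, continuous u} -> {for t, continuous (fun s => harm a (u s))}.
Proof.
move=> du cu; apply: contD.
  apply: contM; first by apply: contM; [exact: cont_cst|exact: cu].
  by apply: contV; [exact: du|apply: den_cont; exact: cu].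
apply: contN; apply: contM; first exact: cont_cst.
by apply: conj_cont; exact: cu.
Qed.
End continuity.

Section surjectivity.
Context {R : realType} (a : R) (a_ge0 : 0 <= a) (a_lt : a < 3^-1).
Implicit Types (z w v q : C R).
Let a_le : a <= 3^-1 := ltW a_lt.

Lemma a_lt_slope z w : closed_disk z -> closed_disk w -> a < cmod (slope a z w).
Proof.
move=> z1 w1; apply: lt_le_trans (cmod_slope_ge a_ge0 a_le z1 w1).
by rewrite -subr_gt0; exact: lip_low_gt0.
Qed.

(** The real-linear map [v |-> m v - a conj(v)] has determinant [|m|^2 - a^2]. *)
Lemma linear_solve (m : C R) q : a < cmod m ->
  exists v, m * v - a%:c * v^* = q.
Proof.
move=> am.
have d0 : m * m^* - a%:c * a%:c != 0.
  apply/eqP => /(congr1 re); rewrite !CE => H.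
  have : a ^+ 2 < cmod m ^+ 2 by rewrite ltr_pXn2r ?nnegrE ?cmod_ge0.
  by rewrite cmod_sqr; move: H; lra.
exists ((m^* * q + a%:c * q^*) / (m * m^* - a%:c * a%:c)).
rewrite fmorph_div rmorphD rmorphB !rmorphM /= !conjCK cst_of_conj (mulrC m^* m).
by field.
Qed.

(** Let [z0] minimise [|f_a - w|] on the closed disk and suppose that
    [p = f_a(z0)] is not [w].  Choose [v] so that the differential at [z0] maps it
    to [q = w - p]; then [f_a(z0 + t v) = p + t B(t)] with [B(t)] close to [q].
    For small [t > 0] this value is closer to [w] than [p] is, and it lies in the
    open disk because [p] lies in the closed disk and [w] in the open one.  Hence
    [z0 + t v] is in the disk, by [harm_disk], even if [z0] is on the circle, so
    the boundary needs no separate treatment. *)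
Lemma harm_surj w : disk R w -> exists2 z, disk R z & harm a z = w.
Proof.
move=> wD.
have closed0 : (@closed_disk R) !=set0 by exists 0; rewrite /closed_disk /= cmod0.
have [|z0 /[!inE] z01 zmin] :=
    @compact_EVT_min _ R (fun z => cmod (harm a z - w)) _ closed0 closed_disk_compact.
  apply: continuous_in_subspaceT => z /[!inE] z1.
  have c : {for z, continuous (fun s => harm a s - w)}.
    apply: contD; last exact: cont_cst.
    by apply: harm_cont; [exact: den_neq0|exact: cont_id].
  exact: (cmod_comp c).
suff e : harm a z0 = w.
  by exists z0 => //; rewrite /disk /= -(harm_disk a_ge0 a_le) ?e//; exact: den_neq0.
apply/eqP; rewrite eq_sym -subr_eq0; apply: contraT => q0.
set p := harm a z0 in q0; set q := w - p in q0.
have [v vE] := linear_solve q (a_lt_slope z01 z01).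
pose zt (t : R) : C R := z0 + t%:c * v.
pose B t : C R := slope a (zt t) z0 * v - a%:c * v^*.
have zt0 : zt 0 = z0 by rewrite /zt (_ : 0%:c = 0)// mul0r addr0.
have B0 : B 0 = q by rewrite /B zt0.
have czt : {for (0 : R), continuous zt}.
  apply: contD; first exact: cont_cst.
  apply: contM; last exact: cont_cst.
  by apply: cst_of_cont; exact: cvg_id.
have dz0 : den a z0 != 0 by exact: den_neq0.
have cB : {for (0 : R), continuous B}.
  apply: contD; last exact: cont_cst.
  apply: contM; last exact: cont_cst.
  by apply: slope_cont; [rewrite zt0|exact: dz0|exact: czt|exact: cont_cst].
have cq0 : 0 < cmod q.
  by rewrite lt_def cmod_ge0 andbT; apply: contra_neq q0; exact: cmod_eq0.
have w1 : 0 < 1 - cmod w by rewrite subr_gt0.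
(* [e <= cmod q] makes the distance to [w] decrease; [e <= 1 - cmod w] keeps the
   value in the disk *)
pose e := Num.min (cmod q) (1 - cmod w).
have e0 : 0 < e by rewrite lt_min cq0.
have nearB : \forall t \near (0 : R), cmod (B t - q) < e.
  by move/cvg_cmod : cB => /(_ _ e0); rewrite B0.
have neard : \forall t \near (0 : R), den a (zt t) != 0.
  by apply: cont_near_neq0; [apply: den_cont; exact: czt|rewrite zt0].
have nearBd : nbhs (0 : R) [set t | cmod (B t - q) < e /\ den a (zt t) != 0].
  exact: filterI nearB neard.
have /nbhs_ballP[d /= d0 dP] := nearBd.
pose t := Num.min (d / 2) 2^-1.
have t0 : 0 < t by rewrite /t lt_min divr_gt0 //= invr_gt0.
have t1 : t < 1 by rewrite /t gt_min; apply/orP; right; rewrite invf_lt1 ?ltr1n.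
have [Bt dt] : cmod (B t - q) < e /\ den a (zt t) != 0.
  apply: dP; rewrite /ball /= sub0r normrN gtr0_norm// /t gt_min.
  by apply/orP; left; lra.
have Fzt : harm a (zt t) = p + t%:c * B t.
  apply/eqP; rewrite addrC -subr_eq; apply/eqP; rewrite harm_sub//.
  have -> : zt t - z0 = t%:c * v by rewrite /zt addrAC subrr add0r.
  rewrite rmorphM /= cst_of_conj.
  by rewrite /B; ring.
have p1 : cmod p <= 1 by exact: harm_closed_disk.
have cE : cmod (1 - t)%:c = 1 - t by rewrite cmod_real ger0_norm// subr_ge0 ltW.
have ctE : cmod t%:c = t by rewrite cmod_real gtr0_norm.
have c1t : (1 - t)%:c = 1 - t%:c by apply: C_eq; rewrite !CE ?subr0.
have teB : t * cmod (B t - q) < t * e by rewrite ltr_pM2l.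
have ztD : disk R (zt t).
  rewrite /disk /= -(harm_disk a_ge0 a_le)// Fzt.
  have -> : p + t%:c * B t = (1 - t)%:c * p + (t%:c * w + t%:c * (B t - q)).
    by rewrite c1t /q; ring.
  apply: le_lt_trans (cmodD _ _) _; rewrite cmodM cE.
  apply: (@lt_le_trans _ _ ((1 - t) * 1 + (t * cmod w + t * e))); last first.
    have : t * e <= t * (1 - cmod w) by rewrite ler_pM2l// ge_min lexx orbT.
    lra.
  apply: ler_ltD; first by rewrite ler_wpM2l// subr_ge0 ltW.
  apply: le_lt_trans (cmodD _ _) _; rewrite !cmodM ctE.
  by rewrite ltrD2l.
have ztc : zt t \in (@closed_disk R) by rewrite inE; exact: disk_closed.
have := zmin _ ztc; rewrite leNgt => /negP[].
rewrite Fzt -/p (cmodB p) -/q.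
have -> : p + t%:c * B t - w = (1 - t)%:c * - q + t%:c * (B t - q).
  by rewrite c1t /q; ring.
apply: le_lt_trans (cmodD _ _) _; rewrite !cmodM cE ctE cmodN.
have : t * e <= t * cmod q by rewrite ler_pM2l// ge_min lexx.
lra.
Qed.

(** [harm a] cut off outside of the disk, as the elements of [HQ R] have to be. *)
Definition harm_map z : C R := if `[< disk R z >] then harm a z else 0.

Lemma harm_mapE z : disk R z -> harm_map z = harm a z.
Proof. by move=> zD; rewrite /harm_map asboolT. Qed.

Lemma harm_map_homeo : homeomorphism_of (disk R) harm_map.
Proof.
have FD z : disk R z -> disk R (harm a z).
  by move=> zD; rewrite /disk /= harm_disk//; apply: den_neq0 => //; exact: disk_closed.
have /choice[g gP] : forall w, exists z, disk R w -> disk R z /\ harm a z = w.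
  move=> w; have [wD|nwD] := pselect (disk R w); last by exists 0.
  by have [z zD zw] := harm_surj wD; exists z.
have lip := lip_low_gt0 a_ge0 a_lt.
exists g; split.
- by move=> z zD; rewrite harm_mapE//; exact: FD.
- by move=> w /gP[].
- split=> z zD; last by have [gD gz] := gP _ zD; rewrite harm_mapE.
  rewrite harm_mapE//; have [gD gz] := gP _ (FD _ zD).
  have := harm_lip_low a_ge0 a_le (disk_closed gD) (disk_closed zD).
  rewrite gz subrr cmod0 pmulr_rle0// => H; apply/eqP; rewrite -subr_eq0.
  by apply/eqP/cmod_eq0/eqP; rewrite eq_le H cmod_ge0.
- move=> z /[!inE] zD.
  have : harm a w @[w --> z] --> harm a z.
    by apply: harm_cont; [apply: den_neq0 => //; exact: disk_closed|exact: cont_id].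
  rewrite -(harm_mapE zD).
  have E : \forall w \near z, harm a w = harm_map w.
    by apply: filterS (disk_nbhs zD) => w wD; rewrite harm_mapE.
  exact: near_eq_cvg_to E.
- move=> w /[!inE] wD; apply/(@cvg_cmod R _ (nbhs w) _) => e e0.
  have [gwD gw] := gP _ wD.
  have le0 : 0 < lip_low a * e by rewrite mulr_gt0.
  have near1 : \forall y \near w, cmod (y - w) < lip_low a * e.
    by apply/nbhs_cmod; exists (lip_low a * e).
  apply: filterS (filterI near1 (disk_nbhs wD)) => y [yw yD].
  have [gyD gy] := gP _ yD.
  have := harm_lip_low a_ge0 a_le (disk_closed gyD) (disk_closed gwD).
  by rewrite gy gw => /le_lt_trans/(_ yw); rewrite ltr_pM2l.
Qed.

End surjectivity.

(** * Orientation and absolute continuity *)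

Section argument.
Context {R : realType}.
Implicit Types (z w : C R) (s t : R).

Definition has_arg w t := w = mkC (cmod w) 0 * cis t.

Lemma cisD s t : cis (s + t) = cis s * cis t :> C R.
Proof. by apply: C_eq; rewrite /cis !CE ?cosD ?sinD//; ring. Qed.
Lemma cis0 : cis 0 = 1 :> C R.
Proof. by rewrite /cis cos0 sin0. Qed.
Lemma cis_neq0 t : cis t != 0 :> C R.
Proof.
apply/eqP => c0; have := cisD t (- t); rewrite subrr cis0 c0 mul0r.
by move/eqP; rewrite oner_eq0.
Qed.
Lemma cisN t : cis (- t) = (cis t)^-1 :> C R.
Proof.
have t0 := cis_neq0 t.
by apply: (mulfI t0); rewrite -cisD subrr cis0 divff.
Qed.
Lemma cis_conj t : (cis t)^* = cis (- t) :> C R.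
Proof. by apply: C_eq; rewrite /cis !CE ?cosN ?sinN. Qed.
Lemma cmod_cis t : cmod (cis t) = 1.
Proof.
apply/eqP; rewrite -(eqrXn2 (n := 2))// ?cmod_ge0// cmod_sqr /cis !CE.
by rewrite cos2Dsin2 expr1n.
Qed.
Lemma cis2pi : cis (pi *+ 2) = 1 :> C R.
Proof. by rewrite /cis cos2pi sin2pi. Qed.

Lemma mkC_realM s t : mkC (s * t) 0 = mkC s 0 * mkC t 0 :> C R.
Proof. by apply: C_eq; rewrite !CE; ring. Qed.

Lemma has_argM z w s t : has_arg z s -> has_arg w t -> has_arg (z * w) (s + t).
Proof.
rewrite /has_arg => zs wt; rewrite cmodM mkC_realM cisD {1}zs {1}wt; ring.
Qed.

Lemma has_argV z s : has_arg z s -> has_arg z^-1 (- s).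
Proof.
rewrite /has_arg => zs; rewrite cmodV cisN {1}zs invfM; congr (_ * _).
have [->|c0] := eqVneq (cmod z) 0; first by rewrite (_ : mkC 0 0 = 0)// !invr0.
have c0' : mkC (cmod z) 0 != 0 :> C R by apply: contra_neq c0 => /(congr1 re).
apply: (mulfI c0'); rewrite divff// -mkC_realM divff//.
Qed.

Lemma has_arg_real s t : 0 <= s -> has_arg (mkC s 0 * cis t) t.
Proof. by move=> s0; rewrite /has_arg cmodM cmod_cis mulr1 cmod_real ger0_norm. Qed.

(** The principal argument on the right half-plane, where it is continuous. *)
Definition arg_half w : R := atan (im w / re w).

Lemma has_arg_half w : 0 < re w -> has_arg w (arg_half w).
Proof.
move=> w0; set t := arg_half w.
have ct : 0 < cos t by apply: cos_gt0_pihalf; rewrite atan_gtNpi2 atan_ltpi2.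
have tt : sin t = cos t * (im w / re w).
  by rewrite -[im w / re w]atanK -/(arg_half w) -/t /tan mulrC divfK// gt_eqF.
have ctE : cos t * cmod w = re w.
  have h0 : 0 <= cos t * cmod w by rewrite mulr_ge0 ?cmod_ge0// ltW.
  apply/eqP; rewrite -(eqrXn2 (n := 2))// ?(ltW w0)//.
  rewrite exprMn cmod_sqr; have := cos2Dsin2 t; rewrite tt => H.
  have -> : re w ^+ 2 + im w ^+ 2 = re w ^+ 2 * (1 + (im w / re w) ^+ 2).
    by field; rewrite gt_eqF.
  rewrite mulrCA mulrDr mulr1 -exprMn H mulr1//.
rewrite /has_arg; apply: C_eq; rewrite /cis !CE mul0r ?subr0 ?addr0.
  by rewrite mulrC ctE.
by rewrite tt mulrA (mulrC (cmod w)) ctE mulrC divfK// gt_eqF.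
Qed.

Lemma arg_half_cont (T : topologicalType) (x : T) (u : T -> C R) :
  {for x, continuous u} -> 0 < re (u x) -> {for x, continuous (fun y => arg_half (u y))}.
Proof.
move=> cu u0.
have c : {for x, continuous (fun y => im (u y) / re (u y))}.
  apply: (@cvgM R T (nbhs x)); first exact: (im_comp cu).
  by apply: (@cvgV R T (nbhs x)); [rewrite gt_eqF|exact: (re_comp cu)].
exact: (cvg_comp _ _ c (@continuous_atan R _)).
Qed.

Lemma cis_cont t : {for t, continuous (cis : R -> C R)}.
Proof.
exact: (@mkC_cvg R R (nbhs t) _ cos sin _ _ (@continuous_cos R t) (@continuous_sin R t)).
Qed.

Lemma re_1D_gt0 z : cmod z < 1 -> 0 < re (1 + z).
Proof.
move=> z1; rewrite !CE; have := cmod_re z.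
by rewrite ler_norml => /andP[] ? _; lra.
Qed.

End argument.

Section orientation.
Context {R : realType} (a : R) (a_ge0 : 0 <= a) (a_lt : a < 3^-1).
Implicit Types (z w : C R).
Let a_le : a <= 3^-1 := ltW a_lt.

Lemma re_1D_mul z w : closed_disk z -> closed_disk w -> 0 < re (1 + a%:c * (z * w)).
Proof.
move=> z1 w1; apply: re_1D_gt0; apply: le_lt_trans (cmod_mul_le a_ge0 z1 w1) _.
by move: a_lt; lra.
Qed.
Lemma re_den z : closed_disk z -> 0 < re (den a z).
Proof.
move=> z1; apply: re_1D_gt0; rewrite cmodN.
apply: le_lt_trans (cmod_mul_le a_ge0 z1 z1) _.
by move: a_lt; lra.
Qed.

(** With [u = r e^(it)] and [P = M(z0 + u, z0)], the increment is
    [P u - a conj(u) = u P Q], where [Q = 1 - (a / P) conj(u) / u] stays in the right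
    half-plane since [|P| > a].  The three factors of [P] stay there too.  So the
    argument of the increment is [t] plus a sum of principal arguments, and these
    are [2 pi]-periodic functions of [t]. *)
Lemma harm_orientation : orientation_preserving_on (disk R) (harm_map a).
Proof.
move=> z0 r r0 sub.
have z0D : disk R z0 by apply: sub; rewrite subrr cmod0 ltW.
pose z (t : R) : C R := z0 + mkC r 0 * cis t.
have zD t : disk R (z t).
  by apply: sub; rewrite /z addrAC subrr add0r cmodM cmod_cis mulr1 cmod_real gtr0_norm.
have z01 := disk_closed z0D; have z1 t := disk_closed (zD t).
pose P t := slope a (z t) z0.
have aP t : a < cmod (P t) by exact: a_lt_slope.
have P0 t : P t != 0.
  apply/eqP => Pt0; have := aP t; rewrite Pt0 cmod0 ltNge.
  by rewrite a_ge0.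
pose Q t := 1 - a%:c / P t * (cis (- t) * cis (- t)).
have Q0 t : 0 < re (Q t).
  apply: re_1D_gt0; rewrite cmodN 3!cmodM !cmod_cis cmodV !mulr1 (cmod_cst a_ge0).
  by rewrite ltr_pdivrMr ?mul1r// (le_lt_trans a_ge0).
pose th t := t + ((0 + arg_half (1 + a%:c * (z t * z0))) -
   (arg_half (den a (z t)) + arg_half (den a z0))) + arg_half (Q t).
have cz t : {for t, continuous z}.
  apply: contD; first exact: cont_cst.
  by apply: contM; [exact: cont_cst|exact: cis_cont].
have z2pi : z (pi *+ 2) = z 0 by rewrite /z cis2pi cis0.
exists th; split.
- apply: continuous_in_subspaceT => t _.
  have cd : {for t, continuous (fun t => den a (z t))} by apply: den_cont; exact: cz.
  have dzt := den_neq0 a_ge0 a_le (z1 t).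
  have cP : {for t, continuous P}.
    by apply: slope_cont; [exact: dzt|exact: den_neq0|exact: cz|exact: cont_cst].
  have cN : {for t, continuous (fun t => 1 + a%:c * (z t * z0))}.
    apply: contD; first exact: cont_cst.
    apply: contM; first exact: cont_cst.
    by apply: contM; [exact: cz|exact: cont_cst].
  have ccN : {for t, continuous (fun t => cis (- t) : C R)}.
    exact: (cvg_comp _ _ (@cvgN R R R (nbhs t) _ id t cvg_id) (@cis_cont R (- t))).
  have cQ : {for t, continuous Q}.
    apply: contD; first exact: cont_cst.
    apply: contN; apply: contM.
      by apply: contM; [exact: cont_cst|apply: contV; [exact: P0|exact: cP]].
    by apply: contM; exact: ccN.
  have c1 := arg_half_cont cN (re_1D_mul (z1 t) z01).
  have c2 := arg_half_cont cd (re_den (z1 t)).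
  have c3 := arg_half_cont cQ (Q0 t).
  apply: (@cvgD R R R (nbhs t)); last exact: c3.
  apply: (@cvgD R R R (nbhs t)); first exact: cvg_id.
  apply: (@cvgD R R R (nbhs t)).
    by apply: (@cvgD R R R (nbhs t)); [exact: cvg_cst|exact: c1].
  apply: (@cvgN R R R (nbhs t)).
  by apply: (@cvgD R R R (nbhs t)); [exact: c2|exact: cvg_cst].
- move=> t _; rewrite -/(z t) !harm_mapE//=.
  rewrite harm_sub ?(den_neq0 a_ge0 a_le)//.
  have -> : z t - z0 = mkC r 0 * cis t by rewrite /z addrAC subrr add0r.
  rewrite -/(P t).
  have -> : P t * (mkC r 0 * cis t) - a%:c * (mkC r 0 * cis t)^* =
      mkC r 0 * cis t * P t * Q t.
    rewrite rmorphM /= (cst_of_conj r) cis_conj /Q cisN /cst_of; field.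
    by rewrite P0 cis_neq0.
  apply: has_argM; last exact: has_arg_half.
  apply: has_argM; first by apply: has_arg_real; exact: ltW.
  apply: has_argM.
    apply: has_argM; last by apply: has_arg_half; exact: re_1D_mul.
    have -> : 1 - a%:c * a%:c = mkC (1 - a ^+ 2) 0 * cis 0.
      by rewrite cis0; apply: C_eq; rewrite !CE; ring.
    by apply: has_arg_real; move: a_ge0 a_lt; nra.
  apply: has_argV; apply: has_argM; apply: has_arg_half; exact: re_den.
- rewrite /th /Q /P z2pi oppr0 cisN cis2pi cis0 invr1; ring.
Qed.

Lemma harm_ACL : ACL_on (disk R) (harm_map a).
Proof.
have lip (p : R -> C R) (b c : R) :
    (forall t, b <= t <= c -> disk R (p t)) ->
    (forall s t, cmod (p t - p s) = `|t - s|) ->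
    abs_continuous b c (fun t => harm_map a (p t)).
  move=> pD pd e e0; exists (e / 4); first by rewrite divr_gt0.
  move=> n s t st _ sum.
  apply: (@le_lt_trans _ _ (\sum_(i < n) 4 * (t i - s i))).
    apply: ler_sum => i _; have [bs si tc] := st i.
    have sD : disk R (p (s i)) by apply: pD; rewrite bs (le_trans si).
    have tD : disk R (p (t i)) by apply: pD; rewrite tc andbT (le_trans bs).
    rewrite !harm_mapE//.
    have := harm_lip a_ge0 a_le (disk_closed tD) (disk_closed sD).
    by rewrite pd ger0_norm// subr_ge0.
  by rewrite -mulr_sumr; move: sum; rewrite ltr_pdivlMr// mulrC.
move=> b c b' c' bc bc' sub; split; apply: aeW => y yb.
- apply: (lip (fun x => mkC x y)); first by move=> x xb; exact: sub.
  move=> s t; rewrite -cmod_real; congr cmod.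
  by apply: C_eq; rewrite !CE ?subrr.
- apply: (lip (fun x => mkC y x)); first by move=> x xb; exact: sub.
  move=> s t; rewrite (_ : _ - _ = mkC 0 (t - s)); last first.
    by apply: C_eq; rewrite !CE ?subrr.
  exact: cmod_imag.
Qed.

End orientation.

(** * Harmonicity and the Wirtinger derivatives *)

Section harmonicity.
Context {R : realType} (a : R) (a_ge0 : 0 <= a) (a_le : a <= 3^-1).
Implicit Types (z w : C R) (f : C R -> C R).

(** The second derivative of [hol a]. *)
Definition hol2 z : C R :=
  (1 - a%:c * a%:c) * (6 * a%:c * z + 2 * a%:c * a%:c * (z * z * z)) /
  (den a z * den a z * den a z).

Lemma den_derive z : complex_derive z (den a) (- (2 * a%:c * z)).
Proof.
have -> : - (2 * a%:c * z) = 0 + (- 1) * (a%:c * (1 * z + z * 1)) by ring.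
have -> : den a = (fun w => 1 + (-1) * (a%:c * (w * w))).
  by apply/funext => w; rewrite /den mulN1r.
apply: complex_deriveD; first exact: complex_derive_cst.
apply/complex_deriveZ/complex_deriveZ.
by apply: complex_deriveM; exact: complex_derive_id.
Qed.

Lemma hol_derive z : den a z != 0 -> complex_derive z (hol a) (slope a z z).
Proof.
move=> dz; have dV := complex_deriveV dz (den_derive z).
have := complex_deriveM (complex_deriveZ (1 - a%:c * a%:c) (complex_derive_id z)) dV.
congr (complex_derive _ _ _); rewrite /slope; move: dz; rewrite /den => dz.
by field.
Qed.

Lemma slope_derive z : den a z != 0 -> complex_derive z (fun w => slope a w w) (hol2 z).
Proof.
move=> dz; have dD := complex_deriveM (den_derive z) (den_derive z).
have dV := @complex_deriveV _ z (fun w => den a w * den a w) _ (mulf_neq0 dz dz) dD.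
have dN := complex_deriveZ (1 - a%:c * a%:c) (complex_deriveD (complex_derive_cst z 1)
  (complex_deriveZ a%:c (complex_deriveM (complex_derive_id z) (complex_derive_id z)))).
have := complex_deriveM dN dV.
congr (complex_derive _ _ _); rewrite /hol2; move: dz; rewrite /den => dz.
by field.
Qed.

Lemma hol2_cont z : den a z != 0 -> {for z, continuous hol2}.
Proof.
move=> dz; have cd : {for z, continuous (den a)} by apply: den_cont; exact: cont_id.
have cz : {for z, continuous (fun w : C R => w)} by exact: cont_id.
apply: contM; last first.
  apply: contV; first by rewrite !mulf_neq0.
  by apply: contM; [apply: contM; exact: cd|exact: cd].
apply: contM; first exact: cont_cst.
apply: contD; (apply: contM; first exact: cont_cst); first exact: cz.
by apply: contM; [apply: contM; exact: cz|exact: cz].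
Qed.

(** The results below hold for any map that agrees with [harm a] on the disk: they
    are needed for [harm_map a], and for a possible limit in [HQ R] of such maps,
    where [a = 1/3]. *)
Section agreeing.
Context f (fE : forall z, disk R z -> f z = harm a z).

Let dN0 z : disk R z -> den a z != 0.
Proof. by move=> /disk_closed; exact: den_neq0. Qed.

Lemma re_harm z : re (harm a z) = re (hol a z + (- a%:c) * z).
Proof. by rewrite /harm !reD mulNr !reN !reM !CE; ring. Qed.
(** [- i (h + a z)] is the holomorphic function whose real part is [im f_a]. *)
Lemma im_harm z : im (harm a z) = re (mkC 0 (-1) * (hol a z + a%:c * z)).
Proof. by rewrite /harm !CE; ring. Qed.

Lemma re_part_derive z : den a z != 0 ->
  complex_derive z (fun w => hol a w + (- a%:c) * w) (slope a z z + (- a%:c)).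
Proof.
move=> dz; apply: complex_deriveD; first exact: hol_derive.
by rewrite -[X in complex_derive _ _ X]mulr1; apply/complex_deriveZ/complex_derive_id.
Qed.
Lemma im_part_derive z : den a z != 0 ->
  complex_derive z (fun w => mkC 0 (-1) * (hol a w + a%:c * w))
    (mkC 0 (-1) * (slope a z z + a%:c)).
Proof.
move=> dz; apply: complex_deriveZ; apply: complex_deriveD; first exact: hol_derive.
by rewrite -[X in complex_derive _ _ X]mulr1; apply/complex_deriveZ/complex_derive_id.
Qed.

Lemma harm_harmonic : harmonic_on (disk R) f.
Proof.
split.
- apply: (@re_holomorphic_harmonic _ _ (fun w => hol a w + (- a%:c) * w)
    (fun w => slope a w w + (- a%:c)) hol2).
  + exact: disk_nbhs.
  + by move=> z /dN0; exact: re_part_derive.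
  + move=> z /dN0 dz; rewrite -[hol2 z]addr0.
    by apply: complex_deriveD; [exact: slope_derive|exact: complex_derive_cst].
  + by move=> z /dN0; exact: hol2_cont.
  + by move=> z zD; rewrite /= fE// re_harm.
- apply: (@re_holomorphic_harmonic _ _ (fun w => mkC 0 (-1) * (hol a w + a%:c * w))
    (fun w => mkC 0 (-1) * (slope a w w + a%:c)) (fun w => mkC 0 (-1) * hol2 w)).
  + exact: disk_nbhs.
  + by move=> z /dN0; exact: im_part_derive.
  + move=> z /dN0 dz; apply: complex_deriveZ; rewrite -[hol2 z]addr0.
    by apply: complex_deriveD; [exact: slope_derive|exact: complex_derive_cst].
  + move=> z /dN0 dz; apply: contM; [exact: cont_cst|exact: hol2_cont].
  + by move=> z zD; rewrite /= fE// im_harm.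
Qed.

Lemma harm_wirtinger z : disk R z -> d_z f z = slope a z z /\ d_zbar f z = - a%:c.
Proof.
move=> zD; have dz := dN0 zD.
have p1 : is_partials z (re \o f) (re (slope a z z) - a) (- im (slope a z z)).
  have := complex_derive_partials (re_part_derive dz).
  have -> : re (slope a z z + - a%:c) = re (slope a z z) - a by rewrite reD.
  have -> : im (slope a z z + - a%:c) = im (slope a z z) by rewrite imD imN subr0.
  apply: is_partials_near; apply: filterS (disk_nbhs zD) => w wD.
  by rewrite /= fE// re_harm.
have p2 : is_partials z (im \o f) (im (slope a z z)) (re (slope a z z) + a).
  have := complex_derive_partials (im_part_derive dz).
  have -> : re (mkC 0 (-1) * (slope a z z + a%:c)) = im (slope a z z).
    by rewrite reM imD reD /=; ring.
  have -> : - im (mkC 0 (-1) * (slope a z z + a%:c)) = re (slope a z z) + a.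
    by rewrite imM imD reD /=; ring.
  apply: is_partials_near; apply: filterS (disk_nbhs zD) => w wD.
  by rewrite /= fE// im_harm.
have [_ x1 y1] := is_partialsE p1; have [_ x2 y2] := is_partialsE p2.
have two0 : (2 : C R) != 0 by rewrite pnatr_eq0.
split; apply: (mulIf two0); rewrite divfK//.
- rewrite /cpartial_x /cpartial_y x1 x2 y1 y2 mulrDr mulr1.
  by move: (slope a z z) => S; apply: C_eq; rewrite !CE; ring.
- rewrite /cpartial_x /cpartial_y x1 x2 y1 y2 mulrDr mulr1.
  by move: (slope a z z) => S; apply: C_eq; rewrite !CE; ring.
Qed.

End agreeing.
End harmonicity.

(** * Quasiconformality for a < 1/3, and its failure for a = 1/3 *)

Section elements.
Context {R : realType}.
Implicit Types (a b : R) (z w : C R).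

Lemma harm_qc a : 0 <= a -> a < 3^-1 -> quasiconformal_of (disk R) (harm_map a).
Proof.
move=> a_ge0 a_lt; have a_le := ltW a_lt; split.
- exact: harm_map_homeo.
- exact: harm_orientation.
pose m := (1 - a) ^+ 2 / (1 + a).
have am : a < m by rewrite -subr_gt0; exact: lip_low_gt0.
have m0 : 0 < m by exact: le_lt_trans am.
pose k := a / m.
have k0 : 0 <= k by rewrite divr_ge0// ltW.
have k1 : k < 1 by rewrite ltr_pdivrMr// mul1r.
have k1' : 0 < 1 - k by rewrite subr_gt0.
(* the [K] with [(K - 1) / (K + 1) = k] *)
exists ((1 + k) / (1 - k)); first by rewrite ler_pdivlMr// mul1r; lra.
split; first exact: harm_ACL.
apply: aeW => -[x y] /= zD; set z := mkC x y in zD *.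
have [-> ->] := harm_wirtinger a_ge0 a_le (@harm_mapE R a) zD.
rewrite cmodN (cmod_cst a_ge0).
have -> : ((1 + k) / (1 - k) - 1) / ((1 + k) / (1 - k) + 1) = k.
  field; rewrite gt_eqF//=.
  by have -> : 1 + k + (1 - k) = 2 :> R by ring.
have := cmod_slope_ge a_ge0 a_le (disk_closed zD) (disk_closed zD).
rewrite -/m => H; apply: (@le_trans _ _ (k * m)); first by rewrite divfK// gt_eqF.
by rewrite ler_wpM2l.
Qed.

Lemma harm_map_out a z : ~ disk R z -> harm_map a z = 0.
Proof. by move=> zD; rewrite /harm_map asboolF. Qed.

Definition harm_HQ a (a_ge0 : 0 <= a) (a_lt : a < 3^-1) : HQ R :=
  @mkHQ R (harm_map a) (@harm_map_out a) (harm_qc a_ge0 a_lt)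
    (harm_harmonic a_ge0 (ltW a_lt) (@harm_mapE R a)).

Lemma harm_dist a b z : 0 <= a -> a <= 3^-1 -> 0 <= b -> b <= 3^-1 ->
  closed_disk z -> cmod (harm a z - harm b z) <= 6 * `|a - b|.
Proof.
move=> a0 a3 b0 b3 z1.
have da := den_neq0 a0 a3 z1; have db := den_neq0 b0 b3 z1.
have -> : harm a z - harm b z = (a - b)%:c *
   (z * ((1 + (a * b)%:c) * (z * z) - (a + b)%:c) / (den a z * den b z) - z^*).
  have -> : (a - b)%:c = a%:c - b%:c by apply: C_eq; rewrite !CE ?subr0.
  have -> : (a + b)%:c = a%:c + b%:c by apply: C_eq; rewrite !CE ?addr0.
  have -> : (a * b)%:c = a%:c * b%:c by apply: C_eq; rewrite !CE; ring.
  by rewrite /harm /hol; move: da db; rewrite /den => da db; field; rewrite da db.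
rewrite cmodM cmod_real mulrC ler_wpM2r//.
apply: le_trans (cmodD _ _) _; rewrite cmodN cmod_conj.
have z1' : cmod z <= 1 by [].
have /andP[dal _] := cmod_den a0 z1; have /andP[dbl _] := cmod_den b0 z1.
(* the bound is in fact [(10/9 + 2/3) / (2/3)^2 = 4] *)
suff : cmod (z * ((1 + (a * b)%:c) * (z * z) - (a + b)%:c) / (den a z * den b z)) <= 5 by lra.
rewrite cmodM cmodV (cmodM (den a z)).
have p0 : 4 / 9 <= cmod (den a z) * cmod (den b z).
  have -> : 4 / 9 = (2 / 3) * (2 / 3) :> R by field.
  by apply: ler_pM; lra.
rewrite ler_pdivrMr; last by lra.
apply: (@le_trans _ _ (5 * (4 / 9))); last by rewrite ler_wpM2l.
rewrite cmodM -[leRHS]mul1r ler_pM ?cmod_ge0//.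
apply: le_trans (cmodD _ _) _; rewrite cmodN cmod_real ger0_norm ?addr_ge0//.
have e1 : cmod (1 + (a * b)%:c) <= 1 + 1 / 9.
  apply: le_trans (cmodD _ _) _; rewrite cmod1 cmod_real ger0_norm ?mulr_ge0// lerD2l.
  have -> : 1 / 9 = 3^-1 * 3^-1 :> R by field.
  by apply: ler_pM.
have : cmod ((1 + (a * b)%:c) * (z * z)) <= (1 + 1 / 9) * (1 * 1).
  by rewrite !cmodM; apply: ler_pM; rewrite ?mulr_ge0 ?cmod_ge0// ler_pM ?cmod_ge0.
lra.
Qed.

(** A square has positive area, so a property that holds almost everywhere holds
    at one of its points. *)
Lemma rectangle_ae (x y e : R) (P : R * R -> Prop) : 0 < e ->
  {ae (@lebesgue_measure R \x @lebesgue_measure R)%E, forall p, P p} ->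
  exists2 p : R * R, `|p.1 - x| < e /\ `|p.2 - y| < e & P p.
Proof.
move=> e0 [N [mN N0 PN]]; apply: contrapT => noP.
pose I (c : R) : set R := `]c - e, c + e[%classic.
have sub : I x `*` I y `<=` N.
  move=> p []; rewrite /I /= !in_itv /= => px py; apply: PN => /= Pp; apply: noP.
  by exists p => //; split; rewrite ltr_distl.
have : ((@lebesgue_measure R \x @lebesgue_measure R) (I x `*` I y) <= 0)%E.
  rewrite -N0; apply: le_measure; rewrite ?inE//.
  by apply: measurableX; exact: measurable_itv.
rewrite product_measure1E; [|exact: measurable_itv|exact: measurable_itv].
have lI c : lebesgue_measure (I c) = (e + e)%:E.
  rewrite /I lebesgue_measure_itv /= lte_fin.
  have -> : c - e < c + e by lra.
  by rewrite -EFinB; congr EFin; ring.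
rewrite [X in (X <= _)%E](_ : _ = ((e + e) * (e + e))%:E); last first.
  by rewrite EFinM; congr (_ * _)%E; exact: lI.
by rewrite lee_fin leNgt mulr_gt0// addr_gt0.
Qed.

(** The critical value: at the boundary point [i] the derivative of [hol a] has
    modulus [a] when [a = 1/3]. *)
Lemma slope_i : cmod (slope 3^-1 (mkC 0 1) (mkC 0 1) : C R) = 3^-1.
Proof.
suff -> : slope 3^-1 (mkC 0 1) (mkC 0 1) = (3^-1 : R)%:c by rewrite cmod_cst.
have i2 : mkC 0 1 * mkC 0 1 = -1 :> C R by apply: C_eq; rewrite !CE; ring.
have e3 : (3^-1 : R)%:c = 3^-1 :> C R.
  have t0 : (3 : C R) != 0 by rewrite pnatr_eq0.
  apply: (mulfI t0); rewrite divff//.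
  have -> : 3 = 1 + 1 + 1 :> C R by ring.
  by apply: C_eq; rewrite !CE; field.
by rewrite /slope /den i2 !e3; field; rewrite ?pnatr_eq0.
Qed.

(** If the dilatation were bounded by [k < 1], then [1/3 <= k |M(z,z)|] would hold
    almost everywhere in the disk.  But [k |M(i,i)| = k / 3 < 1/3], and by continuity
    the reverse inequality holds near [i], hence near some point [i (1 - s)] of
    the disk, on an open set. *)
Lemma harm_third_not_qc f : (forall z, disk R z -> f z = harm 3^-1 z) ->
  ~ quasiconformal_of (disk R) f.
Proof.
move=> fE [_ _ [K K1 [_ dil]]].
have a0 : (0 : R) <= 3^-1 by rewrite invr_ge0.
pose k := (K - 1) / (K + 1).
have k0 : 0 <= k by rewrite divr_ge0//; lra.
have k1 : k < 1 by rewrite ltr_pdivrMr; lra.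
pose i : C R := mkC 0 1.
have i1 : closed_disk i.
  by rewrite /closed_disk /= cmod_le// expr0n add0r.
pose S z := cmod (slope 3^-1 z z).
have cS z : closed_disk z -> {for z, continuous S}.
  move=> z1; have dz := den_neq0 a0 (lexx _) z1.
  by apply: cmod_comp; apply: slope_cont; [exact: dz|exact: dz|exact: cont_id|exact: cont_id].
have near_small z : closed_disk z -> k * S z < 3^-1 ->
    exists2 e : R, 0 < e & forall w, cmod (w - z) < e -> k * S w < 3^-1.
  move=> z1 kS; apply/nbhs_cmod.
  have c : {for z, continuous (fun w => k * S w)}.
    apply: (@cvgM R _ (nbhs z)); [exact: cvg_cst|exact: (cS _ z1)].
  apply: (c [set t | t < 3^-1]); apply: open_nbhs_nbhs; split; [exact: open_lt|exact: kS].
have [|e e0 eP] := near_small i i1.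
  by rewrite /S slope_i; rewrite -[ltRHS]mul1r ltr_pM2r// invr_gt0.
pose s : R := Num.min (e / 2) 2^-1.
have s0 : 0 < s by rewrite /s lt_min divr_gt0 //= invr_gt0.
have s1 : s < 1 by rewrite /s gt_min; apply/orP; right; rewrite invf_lt1 ?ltr1n.
have se : s < e by rewrite /s gt_min; apply/orP; left; lra.
pose z1 : C R := mkC 0 (1 - s).
have z1D : disk R z1 by rewrite /disk /= cmod_imag ger0_norm; lra.
have kz1 : k * S z1 < 3^-1.
  apply: eP; rewrite (_ : z1 - i = mkC 0 (- s)) ?cmod_imag ?normrN ?gtr0_norm//.
  by apply: C_eq; rewrite /z1 /i !CE; ring.
have [d d0 dP] := near_small z1 (disk_closed z1D) kz1.
have [d' d'0 d'P] := (nbhs_cmod _ _).1 (disk_nbhs z1D).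
pose r := Num.min d d' / 2.
have r0 : 0 < r by rewrite divr_gt0// lt_min d0.
have [[x y] /= [xr yr]] := rectangle_ae 0 (1 - s) r0 dil.
have w1 : cmod (mkC x y - z1) < Num.min d d'.
  rewrite (_ : _ - _ = mkC (x - 0) (y - (1 - s))).
    by apply: le_lt_trans (cmod_mkC_le _ _) _; move: xr yr; rewrite /r; lra.
  by apply: C_eq; rewrite /z1 !CE.
move: w1; rewrite lt_min => /andP[wd wd'].
have wD := d'P _ wd'; move=> /(_ wD).
have [-> ->] := harm_wirtinger a0 (lexx _) fE wD.
rewrite cmodN (cmod_cst a0) -/k leNgt => /negP[].
exact: (dP _ wd).
Qed.

End elements.

(** * A Cauchy sequence without limit *)

Section sequence.
Context {R : realType}.

Definition third_seq (n : nat) : R := 3^-1 * (1 - n.+1%:R^-1).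

Lemma third_seq_ge0 n : 0 <= third_seq n.
Proof. by rewrite mulr_ge0 ?invr_ge0// subr_ge0 invf_le1 ?ler1n. Qed.
Lemma third_seq_lt n : third_seq n < 3^-1.
Proof. by rewrite -[ltRHS]mulr1 ltr_pM2l ?invr_gt0// gtrBl invr_gt0. Qed.
Lemma third_seq_dist n : `|third_seq n - 3^-1| <= n.+1%:R^-1.
Proof.
have -> : third_seq n - 3^-1 = - (3^-1 * n.+1%:R^-1) by rewrite /third_seq; ring.
by rewrite normrN ger0_norm ?mulr_ge0 ?invr_ge0// ler_piMl ?invr_ge0// invf_le1 ?ler1n.
Qed.

Definition HQ_seq n : HQ R := harm_HQ (third_seq_ge0 n) (third_seq_lt n).

Lemma HQ_seq_near (n : nat) (z : C R) : disk R z ->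
  cmod (HQ_seq n z - harm 3^-1 z) <= 6 * n.+1%:R^-1.
Proof.
move=> zD; rewrite /HQ_seq /= harm_mapE//.
apply: le_trans (harm_dist (third_seq_ge0 n) (ltW (third_seq_lt n)) _ (lexx _)
  (disk_closed zD)) _.
  by rewrite invr_ge0.
by rewrite ler_wpM2l// third_seq_dist.
Qed.

Lemma HQ_seq_small (e : R) : 0 < e -> exists N, forall n, (N <= n)%N -> 6 * n.+1%:R^-1 < e.
Proof.
move=> e0; exists (Num.truncn (6 / e)) => n Nn.
rewrite ltr_pdivrMr// mulrC -ltr_pdivrMr//.
by apply: lt_le_trans (truncnS_gt _) _; rewrite ler_nat.
Qed.

Lemma HQ_seq_cauchy : cauchy (HQ_seq @ \oo).
Proof.
apply/cauchyP => e e0.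
have e20 : 0 < e / 2 by rewrite divr_gt0.
have [N NP] := HQ_seq_small e20.
exists (HQ_seq N); exists N => // n /= Nn; rewrite ballEmdist /=.
apply: (@le_lt_trans _ _ (6 * N.+1%:R^-1 + 6 * n.+1%:R^-1)).
  apply: d_sup_le => z zD; rewrite -(subrKA (harm 3^-1 z)).
  apply: le_trans (cmodD _ _) _; rewrite lerD ?HQ_seq_near//.
  by rewrite cmodB HQ_seq_near.
by rewrite (splitr e) ltrD// NP.
Qed.

(** A limit for [d_sup] is in particular a pointwise limit. *)
Lemma HQ_seq_limit (l : HQ R) : HQ_seq @ \oo --> l -> forall z, disk R z -> l z = harm 3^-1 z.
Proof.
move=> Hl z zD; apply/eqP; rewrite -subr_eq0; apply/eqP/cmod_eq0/eqP.
rewrite eq_le cmod_ge0 andbT; apply/ler_addgt0Pl => e e0; rewrite addr0.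
have e20 : 0 < e / 2 by rewrite divr_gt0.
have [N NP] := HQ_seq_small e20.
have [M _ MP] : \forall n \near \oo, ball l (e / 2) (HQ_seq n).
  exact: (Hl _ (nbhsx_ballx l _ e20)).
pose n := maxn N M.
have := MP n (leq_maxr _ _); rewrite ballEmdist /= => ln.
rewrite -(subrKA (HQ_seq n z)); apply: le_trans (cmodD _ _) _.
rewrite (splitr e) lerD//.
  by apply: le_trans (d_sup_ub _ _ zD) _; exact: ltW.
by apply: le_trans (HQ_seq_near _ zD) _; rewrite ltW// NP// leq_maxl.
Qed.
End sequence.

Theorem theorem4p1 (R : realType) : ~ complete_metric (HQ R).
Proof.
move=> /(_ HQ_seq HQ_seq_cauchy)[l Hl].
exact: (harm_third_not_qc (HQ_seq_limit Hl) (HQ_qc l)).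
Qed.
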